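(* Let $e_t^s=\sum_{j=1}^{k(n)}\mathbf{1}\{\nu_t^s\in[\sum_{l=0}^{j-1}\omega_l,\sum_{l=0}^{j}\omega_l]\}(\mu_j+\sigma_jZ_{t,j}^s)$ and $\tilde e_t^s=\sum_{j=1}^{k(n)}\mathbf{1}\{\nu_t^s\in[\sum_{l=0}^{j-1}\tilde\omega_l,\sum_{l=0}^{j}\tilde\omega_l]\}(\tilde\mu_j+\tilde\sigma_jZ_{t,j}^s)$, with bounds $|\mu_j|,|\tilde\mu_j|\le\bar\mu_{k(n)}$ and $|\sigma_j|,|\tilde\sigma_j|\le\bar\sigma$, subject to the sieve restrictions stated in the context. If $\mathbb{E}(|Z_{t,j}^s|^2)\le C_Z^2<\infty$, then there exists a finite constant $C$ which only depends on $C_Z$ such that $$\left[\mathbb{E}\left(\sup_{\|f_{\omega,\mu,\sigma}-f_{\tilde\omega,\tilde\mu,\tilde\sigma}\|_m\le\delta}\big|e_t^s-\tilde e_t^s\big|^2\right)\right]^{1/2}\le C\left(1+\bar\mu_{k(n)}+\bar\sigma+k(n)\right)\delta^{1/2},$$ where $\|f_{\omega,\mu,\sigma}-f_{\tilde\omega,\tilde\mu,\tilde\sigma}\|_m=\|(\omega,\mu,\sigma)-(\tilde\omega,\tilde\mu,\tilde\sigma)\|_1$.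
   Context: The weights satisfy $\omega_j,\tilde\omega_j\ge0$, $\sum_{j=1}^{k(n)}\omega_j=\sum_{j=1}^{k(n)}\tilde\omega_j=1$, $\omega_0=\tilde\omega_0=0$. The $\nu_t^s$ are uniform on $[0,1]$ and independent of the component draws $Z_{t,j}^s$; the same $(\nu_t^s,Z_{t,j}^s)$ are used for $e_t^s$ and $\tilde e_t^s$. $f_{\omega,\mu,\sigma}$ denotes the mixture density with parameters $(\omega,\mu,\sigma)$, i.e. the density of $e_t^s$. $k(n)\ge1$ is the number of mixture components. Sieve restrictions: the scale parameters satisfy $\sigma_j,\tilde\sigma_j\ge\underline\sigma_{k(n)}$ with $\underline\sigma_k=O(\log[k]^{2/b}/k)$, and the location bound satisfies $\bar\mu_k=O(\log[k]^{1/b})$, where $b>0$ is the exponential tail index of the thin-tailed component of the density being approximated.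
   Formalization: The sup runs over the tilded parameters only, (ω,μ,σ) being fixed; the cells are half-open rather than closed; C depends only on C_Z once k(n) ≥ K, with K set by the sieve bounds, and for the finitely many smaller k(n) it may also depend on these bounds. As literally stated the claim fails. *)

(* Defs.v *)
From HB Require Import structures.
From mathcomp Require Import all_boot all_order all_algebra.
From mathcomp Require Import all_classical all_reals all_analysis.

Set Implicit Arguments.
Unset Strict Implicit.
Unset Printing Implicit Defensive.

Import Order.TTheory GRing.Theory Num.Theory.
Import numFieldNormedType.Exports.

Local Open Scope classical_set_scope.
Local Open Scope ring_scope.

(* Components are numbered 0, ..., k - 1, so component [j : 'I_k] is the
   [j + 1]-st component of the usual 1-based numbering. *)
Record mixture (R : realType) (k : nat) := Mixture {
  weight : 'I_k -> R ;
  location : 'I_k -> R ;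
  scale : 'I_k -> R }.

(* [\| f_theta - f_theta' \|_m], the l^1 distance of the stacked parameters. *)
Definition mixture_dist (R : realType) (k : nat) (theta theta' : mixture R k) : R :=
  \sum_(j < k) `|weight theta j - weight theta' j|
  + \sum_(j < k) `|location theta j - location theta' j|
  + \sum_(j < k) `|scale theta j - scale theta' j|.

Definition in_sieve (R : realType) (k : nat) (mubar sigbar siglow : R)
    (theta : mixture R k) : Prop :=
  [/\ forall j, 0 <= weight theta j,
      \sum_(j < k) weight theta j = 1,
      forall j, `|location theta j| <= mubar
    & forall j, `|scale theta j| <= sigbar /\ siglow <= scale theta j].

Definition cum_weight (R : realType) (k : nat) (theta : mixture R k) (m : nat) : R :=
  \sum_(l < k | (l < m)%N) weight theta l.

(* The cells are taken half-open so that each point of [0, 1[ lies in exactly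
   one of them.  With closed cells a point shared by several cells would have
   the corresponding components added up; this is a null event for fixed
   weights, but not once a supremum over the weights is taken. *)
Definition cell (R : realType) (k : nat) (theta : mixture R k) (j : 'I_k) : set R :=
  [set u | cum_weight theta j <= u < cum_weight theta j.+1].

(* The draw e as a function of the uniform draw u and of the component draws z. *)
Definition mixture_draw (R : realType) (k : nat) (theta : mixture R k)
    (u : R) (z : 'I_k -> R) : R :=
  \sum_(j < k) \1_(cell theta j) u * (location theta j + scale theta j * z j).

Definition sigma_family d (T : measurableType d) (R : realType) (I : Type)
    (Z : I -> T -> R) : set (set T) :=
  <<s [set A | exists i, exists2 B : set R, measurable B & A = Z i @^-1` B] >>.

Definition indep_of_family d (T : measurableType d) (R : realType)
    (P : probability T R) (I : Type) (X : T -> R) (Z : I -> T -> R) : Prop :=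
  forall (A : set R) (B : set T), measurable A -> sigma_family Z B ->
    P (X @^-1` A `&` B) = (P (X @^-1` A) * P B)%E.

Definition uniform01 d (T : measurableType d) (R : realType)
    (P : probability T R) (X : {RV P >-> R}) : Prop :=
  forall A : set R, measurable A ->
    distribution P X A = uniform_prob (@ltr01 R) A.

(* [E (sup |e - e'|^2)]^(1/2), where theta is fixed and the supremum runs over
   the sieve elements theta' at distance at most delta from theta. *)
Definition local_sup_L2 d (T : measurableType d) (R : realType)
    (P : probability T R) (k : nat) (mubar sigbar siglow : R)
    (nu : T -> R) (Z : 'I_k -> T -> R)
    (theta : mixture R k) (delta : R) : \bar R :=
  ((\int[P]_x ereal_sup
      [set (`|mixture_draw theta (nu x) (Z^~ x)
              - mixture_draw theta' (nu x) (Z^~ x)| ^+ 2)%R%:E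
       | theta' in [set theta' | in_sieve mubar sigbar siglow theta' /\
                                 (mixture_dist theta theta' <= delta)%R]])
   `^ (2^-1)%R)%E.

(* Main.v *)
Require Import Defs.
From HB Require Import structures.
From mathcomp Require Import all_boot all_order all_algebra.
From mathcomp Require Import all_classical all_reals all_analysis.
From mathcomp Require Import measurable_realfun ring lra.

(* Write c_m for the cumulative weights of theta.  For each u in [0, 1[ the draws
   e and e' select single components i and i'.  If i = i', then |e - e'|^2 is at
   most 2 |mu_i - mu'_i|^2 + 2 |sigma_i - sigma'_i|^2 z_i^2, and each squared
   difference is at most delta times a diameter, 2 mubar or 2 sigbar.  If i <> i',
   then, since the cumulative weights of theta and theta' differ by at most delta,
   u is within delta of an endpoint c_m of the cell of theta with index i, and of
   one of the cell with index i'; so z_i^2 and z_i'^2 come multiplied by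
   indicators of balls of radius delta, which are independent of z and have
   probability at most 2 delta.  Integrating the resulting bound, which does not
   depend on theta', gives

     delta * O(mubar + k (sigbar CZ^2 + mubar^2 + sigbar^2 CZ^2)),

   and for large k both mubar^2 and sigbar^2 are at most k, because
   mubar = O((log k)^(1/b)) is o(k^(1/2)). *)

Set Implicit Arguments.
Unset Strict Implicit.
Unset Printing Implicit Defensive.

Import Order.TTheory GRing.Theory Num.Theory.
Import numFieldNormedType.Exports.

Local Open Scope classical_set_scope.
Local Open Scope ring_scope.

(** * Monotonicity of the integral and growth of logarithms *)

(* No measurability: the supremum over theta' in [local_sup_L2] need not be
   measurable, which [ge0_le_integral] would require. *)
Lemma ge0_le_integral_nonmeas d (T : measurableType d) (R : realType)
    (mu : {measure set T -> \bar R}) (f g : T -> \bar R) :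
  (forall x, 0 <= f x)%E -> (forall x, f x <= g x)%E ->
  (\int[mu]_x f x <= \int[mu]_x g x)%E.
Proof.
move=> f0 fg.
have g0 x : (0 <= g x)%E by exact: le_trans (f0 x) (fg x).
rewrite !ge0_integralTE//; apply: ereal_sup_le => _ [h /= hf <-].
by exists h => //= x; exact: le_trans (hf x) (fg x).
Qed.

(* The exponent 1/4, rather than the 1/2 that is needed in the end, leaves room to
   absorb the constant of the O. *)
Lemma ln_powR_le (R : realType) (a x : R) : 0 < a -> 1 <= x ->
  ln x `^ a <= (4 * a) `^ a * x `^ (4^-1).
Proof.
move=> a0 x1; have x0 : 0 < x by exact: lt_le_trans x1.
have a40 : 0 < 4 * a by rewrite mulr_gt0.
(* The bound [ln y <= y] is applied to y = x^(1/(4a)); raising to the power a then leaves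
   x^(1/4). *)
have lnE : ln x = 4 * a * ln (x `^ (4 * a)^-1).
  by rewrite ln_powR mulrA divff ?mul1r// gt_eqF.
have le : ln x <= 4 * a * x `^ (4 * a)^-1.
  by rewrite {1}lnE ler_pM2l// ltW// ln_sublinear// powR_gt0.
apply: (@le_trans _ _ ((4 * a * x `^ (4 * a)^-1) `^ a)).
  apply: ge0_ler_powR => //; rewrite ?nnegrE ?ln_ge0//; first exact: ltW.
  by rewrite mulr_ge0 ?powR_ge0// ltW.
rewrite powRM ?powR_ge0 ?(ltW a40)// -powRrM.
have -> : (4 * a)^-1 * a = 4^-1 by rewrite invfM -mulrA mulVf ?mulr1// gt_eqF.
exact: lexx.
Qed.

(** Beyond the threshold of the O, |u m| <= M m^(1/4). Once m >= M^4, the factor M is itself at most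
    m^(1/4), so |u m| <= m^(1/2). *)
Lemma bigO_ln_powR_sqr_le (R : realType) (a : R) (u : nat -> R) : 0 < a ->
  (u : nat -> R^o) =O_\oo (fun m : nat => ln m%:R `^ a : R^o) ->
  \forall m \near \oo, u m ^+ 2 <= m%:R.
Proof.
move=> a0 /eqO_exP[c /= c0 uO].
pose M : R := c * (4 * a) `^ a.
near=> m.
have m1 : 1 <= (m%:R : R) by rewrite ler1n; near: m; exists 1%N.
have m0 : 0 <= (m%:R : R) by [].
have um : `|u m| <= M * m%:R `^ (4^-1).
  have /le_trans : `|u m| <= c * `|ln m%:R `^ a| by near: m.
  apply; rewrite (ger0_norm (powR_ge0 _ _)) /M -mulrA ler_wpM2l ?(ltW c0)//.
  exact: ln_powR_le.
have Mm : M ^+ 4 <= m%:R by near: m; exact: nbhs_infty_ger.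
rewrite -real_normK ?num_real//.
have sq : (m%:R `^ (4^-1) : R) ^+ 4 = m%:R.
  by rewrite -powR_mulrn ?powR_ge0// -powRrM mulVf ?powRr1// pnatr_eq0.
have Mr : M <= m%:R `^ (4^-1).
  rewrite -(@ler_pXn2r _ 4)// ?nnegrE ?powR_ge0// ?sq//.
  by rewrite mulr_ge0 ?powR_ge0// ltW.
have ur : `|u m| <= (m%:R `^ (4^-1)) ^+ 2.
  by rewrite (le_trans um)// expr2 ler_wpM2r ?powR_ge0.
rewrite -[leRHS]sq (exprM _ 2 2).
by rewrite ler_pXn2r// nnegrE ?exprn_ge0 ?powR_ge0.
Unshelve. all: by end_near.
Qed.

(** * The uniform law and independence *)

(** The density is at most 1, so the Lebesgue measure of the interval is an upper bound, even when
    the interval sticks out of [0, 1]. *)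
Lemma uniform_prob_ball_le (R : realType) (c r : R) : 0 <= r ->
  (uniform_prob (@ltr01 R) `[(c - r)%R, (c + r)%R] <= (2 * r)%:E)%E.
Proof.
move=> r0; rewrite /uniform_prob.
apply: (@le_trans _ _ (\int[lebesgue_measure]_(x in `[(c - r)%R, (c + r)%R]) (cst 1%E x))%E).
  apply: ge0_le_integral => //=.
  - by move=> x _; rewrite lee_fin uniform_pdf_ge0.
  - apply/measurable_EFinP; apply: measurable_funTS; exact: measurable_uniform_pdf.
  - by move=> x _; rewrite lee_fin /uniform_pdf; case: ifP => // _; rewrite subr0 invr1.
rewrite integral_cst//= mul1e lebesgue_measure_itv/=.
case: ifPn => _; last by rewrite lee_fin mulr_ge0.
by rewrite -EFinD lee_fin; lra.
Qed.

Lemma integral_mrestr d (T : measurableType d) (R : realType)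
    (mu : {measure set T -> \bar R}) (E : set T) (mE : measurable E)
    (g : T -> \bar R) : measurable_fun setT g -> (forall x, 0 <= g x)%E ->
  (\int[mrestr mu mE]_x g x = \int[mu]_x ((\1_E x)%:E * g x))%E.
Proof.
move=> mg g0; rewrite -(setUv E) [LHS]ge0_integral_setU//; last 3 first.
- exact: measurableC.
- by rewrite setUv.
- by apply/disj_setPS; rewrite setICr.
rewrite [X in (_ + X)%E]null_set_integral ?adde0; last 3 first.
- exact: measurableC.
- exact: measurable_funTS.
- by rewrite /= /mrestr setICl measure0.
rewrite (@eq_measure_integral _ _ _ E mu); last first.
  by move=> A mA AE; rewrite /= /mrestr setIidl.
rewrite setUv integral_mkcond; apply: eq_integral => x _.
by rewrite patchE indicE; case: ifP => _; rewrite ?mul1e ?mul0e.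
Qed.

(** By independence, the image under [Z i] of P restricted to the event X in A is P(X in A) times
    the law of [Z i]. The two sides are the integrals of f against these two measures. *)
Lemma integral_indic_indep d (T : measurableType d) (R : realType)
    (P : probability T R) (I : Type) (X : {RV P >-> R}) (Z : I -> {RV P >-> R})
    (i : I) (A : set R) (f : R -> \bar R) :
  indep_of_family P X (fun j => Z j : T -> R) -> measurable A ->
  measurable_fun setT f -> (forall y, 0 <= f y)%E ->
  (\int[P]_x ((\1_A (X x))%:E * f (Z i x))
   = P (X @^-1` A) * \int[P]_x f (Z i x))%E.
Proof.
move=> indep mA mf f0.
have mE : measurable (X @^-1` A).
  by rewrite -(setTI (X @^-1` A)); exact: measurable_funPT.
have mZ : measurable_fun setT (Z i) by exact: measurable_funPT.
have c0 : 0 <= fine (P (X @^-1` A)) by rewrite fine_ge0.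
pose c := NngNum c0.
have cE : (c%:num%:E = P (X @^-1` A))%E by rewrite fineK// fin_num_measure.
rewrite -(integral_mrestr P mE)//; last exact: measurableT_comp.
have pf (mu : {measure set T -> \bar R}) :
    (\int[mu]_x f (Z i x) = \int[pushforward mu (Z i)]_y f y)%E.
  by rewrite ge0_integral_pushforward// preimage_setT.
rewrite !pf (@eq_measure_integral _ _ _ _ (mscale c (pushforward P (Z i)))).
  by rewrite ge0_integral_mscale// cE.
move=> B mB _; rewrite /= /mrestr /mscale/= cE /pushforward setIC; apply: indep => //.
by apply: sub_sigma_algebra; exists i, B.
Qed.

(** * Cumulative weights and the selected component *)

Lemma cum_weight0 (R : realType) k (theta : mixture R k) : cum_weight theta 0 = 0.
Proof. by rewrite /cum_weight big1. Qed.

Lemma cum_weight_total (R : realType) k (theta : mixture R k) :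
  cum_weight theta k = \sum_(j < k) weight theta j.
Proof. by apply: eq_bigl => j; rewrite ltn_ord. Qed.

Lemma le_cum_weight (R : realType) k (theta : mixture R k) (m n : nat) :
  (forall j, 0 <= weight theta j) -> (m <= n)%N ->
  cum_weight theta m <= cum_weight theta n.
Proof.
move=> w0 mn; rewrite /cum_weight !(big_mkcond (fun l : 'I_k => (l < _)%N)).
apply: ler_sum => l _; case: ifPn => [lm|_]; first by rewrite (leq_trans lm).
by case: ifP.
Qed.

Lemma cum_weight_dist (R : realType) k (theta theta' : mixture R k) (m : nat) :
  `|cum_weight theta m - cum_weight theta' m| <= mixture_dist theta theta'.
Proof.
rewrite /cum_weight -sumrB /mixture_dist -addrA.
apply: (le_trans (ler_norm_sum _ _ _)).
rewrite -[leLHS]addr0 lerD ?addr_ge0 ?sumr_ge0//.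
by rewrite big_mkcond ler_sum// => j _; case: ifP.
Qed.

Lemma le_term_sum (R : numDomainType) (I : finType) (F : I -> R) (i : I) :
  (forall j, 0 <= F j) -> F i <= \sum_j F j.
Proof. by move=> F0; rewrite (bigD1 i)//= lerDl sumr_ge0. Qed.

Lemma location_dist (R : realType) k (theta theta' : mixture R k) (j : 'I_k) :
  `|location theta j - location theta' j| <= mixture_dist theta theta'.
Proof.
pose F l := `|location theta l - location theta' l|.
rewrite /mixture_dist addrAC; apply: (le_trans (@le_term_sum _ _ F j _)) => [l|].
  exact: normr_ge0.
by rewrite lerDr addr_ge0 ?sumr_ge0.
Qed.

Lemma scale_dist (R : realType) k (theta theta' : mixture R k) (j : 'I_k) :
  `|scale theta j - scale theta' j| <= mixture_dist theta theta'.
Proof.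
pose F l := `|scale theta l - scale theta' l|.
rewrite /mixture_dist; apply: (le_trans (@le_term_sum _ _ F j _)) => [l|].
  exact: normr_ge0.
by rewrite lerDr addr_ge0 ?sumr_ge0.
Qed.

Lemma cell_inj (R : realType) k (theta : mixture R k) (i j : 'I_k) (u : R) :
  (forall l, 0 <= weight theta l) -> cell theta i u -> cell theta j u -> i = j.
Proof.
move=> w0 /andP[iu ui] /andP[ju uj].
apply: val_inj => /=; case: (ltngtP i j) => // ij.
- by have := lt_le_trans ui (le_trans (le_cum_weight w0 ij) ju); rewrite ltxx.
- by have := lt_le_trans uj (le_trans (le_cum_weight w0 ij) iu); rewrite ltxx.
Qed.

Lemma mixture_draw_cell (R : realType) k (theta : mixture R k) (i : 'I_k)
    (u : R) (z : 'I_k -> R) :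
  (forall l, 0 <= weight theta l) -> cell theta i u ->
  mixture_draw theta u z = location theta i + scale theta i * z i.
Proof.
move=> w0 iu; rewrite /mixture_draw (bigD1 i)//= big1 ?addr0.
  by rewrite indicE mem_set// mul1r.
move=> j ji; rewrite indicE memNset ?mul0r// => ju.
by move/eqP: ji; apply; exact: cell_inj ju iu.
Qed.

Lemma cell_exists (R : realType) k (theta : mixture R k) (u : R) :
  \sum_(j < k) weight theta j = 1 -> 0 <= u < 1 -> exists i, cell theta i u.
Proof.
move=> w1 /andP[u0]; rewrite -w1 -cum_weight_total.
(* The induction locates the first cumulative weight that exceeds u. *)
suff H m : (m <= k)%N -> u < cum_weight theta m -> exists i, cell theta i u.
  exact: H.
elim: m => [_|m IH mk um]; first by rewrite cum_weight0 ltNge u0.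
have [/IH|cu] := ltP u (cum_weight theta m); first by apply; exact: ltnW.
by exists (Ordinal mk); rewrite /cell/= cu.
Qed.

(** Treats u = 1 and points outside [0, 1] directly: both draws vanish there, so the comparison of
    draws holds for every u and not only almost surely. *)
Lemma mixture_draw_outside (R : realType) k (theta : mixture R k) (u : R)
    (z : 'I_k -> R) :
  (forall l, 0 <= weight theta l) -> \sum_(j < k) weight theta j = 1 ->
  ~~ (0 <= u < 1) -> mixture_draw theta u z = 0.
Proof.
move=> w0 w1 u01; rewrite /mixture_draw big1// => j _.
rewrite indicE memNset ?mul0r// => /andP[ju uj].
move/negP: u01; apply; apply/andP; split.
- by apply: le_trans ju; rewrite -(cum_weight0 theta) le_cum_weight.
- by apply: (lt_le_trans uj); rewrite -w1 -cum_weight_total le_cum_weight.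
Qed.

(** * Pointwise bound on the difference of two draws *)

(** It depends on theta alone, hence survives the supremum over theta'. A sum of indicators, which
    may equal 2, lets each ball be integrated separately. *)
Definition cell_ends (R : realType) k (theta : mixture R k) (delta : R)
    (j : 'I_k) (u : R) : R :=
  \1_(`[cum_weight theta j - delta, cum_weight theta j + delta]) u
  + \1_(`[cum_weight theta j.+1 - delta, cum_weight theta j.+1 + delta]) u.

Lemma cell_ends_ge0 (R : realType) k (theta : mixture R k) (delta : R)
  (j : 'I_k) (u : R) : 0 <= cell_ends theta delta j u.
Proof. by rewrite addr_ge0. Qed.

(** Write c and c' for the cumulative weights of theta and theta'. If i < j, then c'_(i+1) <= c'_j
    <= u < c_(i+1) <= c_j. As c and c' differ by at most delta, u is within delta below both
    c_(i+1), an end of cell i, and c_j, an end of cell j. The case i > j is symmetric. *)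
Lemma cell_ends_ge1 (R : realType) k (theta theta' : mixture R k) (delta : R)
    (i j : 'I_k) (u : R) :
  (forall l, 0 <= weight theta l) -> (forall l, 0 <= weight theta' l) ->
  mixture_dist theta theta' <= delta ->
  cell theta i u -> cell theta' j u -> i != j ->
  1 <= cell_ends theta delta i u /\ 1 <= cell_ends theta delta j u.
Proof.
move=> w0 w0' dd /andP[iu ui] /andP[ju uj] ij.
have ends (l : 'I_k) (m : nat) : m = l \/ m = l.+1 ->
    cum_weight theta m - delta <= u <= cum_weight theta m + delta ->
    1 <= cell_ends theta delta l u.
  move=> lm um; rewrite /cell_ends !indicE.
  case: lm um => -> um; first by rewrite mem_set ?lerDl//= in_itv.
  by rewrite -[leLHS]add0r lerD// mem_set//= in_itv.
have dist m : cum_weight theta m - delta <= cum_weight theta' m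
              <= cum_weight theta m + delta.
  have := le_trans (cum_weight_dist theta theta' m) dd.
  by rewrite ler_norml => /andP[? ?]; apply/andP; split; lra.
case: (ltngtP i j) => [lt|gt|/val_inj eq]; last by rewrite eq eqxx in ij.
- have := le_cum_weight w0 lt; have := le_cum_weight w0' lt.
  have /andP[? ?] := dist i.+1; have /andP[? ?] := dist j.
  by move=> ? ?; split; [apply: (ends _ i.+1); auto|apply: (ends _ j); auto];
    apply/andP; split; lra.
- have := le_cum_weight w0 gt; have := le_cum_weight w0' gt.
  have /andP[? ?] := dist i; have /andP[? ?] := dist j.+1.
  by move=> ? ?; split; [apply: (ends _ i); auto|apply: (ends _ j.+1); auto];
    apply/andP; split; lra.
Qed.

(** One factor |x - y| is bounded by r and the other by the diameter 2c. This yields the first power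
    of delta, without assuming delta small. *)
Lemma sqr_normB_le (R : realType) (x y c r : R) :
  `|x| <= c -> `|y| <= c -> `|x - y| <= r -> (x - y) ^+ 2 <= 2 * r * c.
Proof.
move=> xc yc xyr; rewrite -real_normK ?num_real// expr2.
have xy : `|x - y| <= 2 * c by rewrite (le_trans (ler_normB _ _))//; lra.
by rewrite [2 * r]mulrC -mulrA ler_pM.
Qed.

Lemma sqr_mixture_draw_dist (R : realType) k (mubar sigbar siglow delta : R)
    (theta theta' : mixture R k) (u : R) (z : 'I_k -> R) :
  in_sieve mubar sigbar siglow theta -> in_sieve mubar sigbar siglow theta' ->
  mixture_dist theta theta' <= delta -> 0 <= mubar -> 0 <= sigbar ->
  `|mixture_draw theta u z - mixture_draw theta' u z| ^+ 2 <=
  4 * delta * mubar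
  + \sum_(j < k) (4 * delta * sigbar * z j ^+ 2
      + cell_ends theta delta j u * (4 * mubar ^+ 2 + 4 * sigbar ^+ 2 * z j ^+ 2)).
Proof.
move=> [w0 w1 mu sg] [w0' w1' mu' sg'] dd m0 s0.
have d0 : 0 <= delta by apply: le_trans dd; rewrite !addr_ge0 ?sumr_ge0.
pose b l := 4 * mubar ^+ 2 + 4 * sigbar ^+ 2 * z l ^+ 2.
pose a l := 4 * delta * sigbar * z l ^+ 2.
pose G l := a l + cell_ends theta delta l u * b l.
change (`|mixture_draw theta u z - mixture_draw theta' u z| ^+ 2
        <= 4 * delta * mubar + \sum_l G l).
have a0 l : 0 <= a l by apply: mulr_ge0 (sqr_ge0 _); rewrite !mulr_ge0.
have b0 l : 0 <= b l.
  have := sqr_ge0 mubar; have := mulr_ge0 (sqr_ge0 sigbar) (sqr_ge0 (z l)).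
  by rewrite /b; lra.
have aG l : a l <= G l.
  by rewrite lerDl; apply: mulr_ge0 => //; exact: cell_ends_ge0.
have G0 l : 0 <= G l := le_trans (a0 l) (aG l).
have bG l : 1 <= cell_ends theta delta l u -> b l <= G l.
  by move=> e1; rewrite -[leLHS]add0r lerD// ler_peMl.
have dm0 : 0 <= 4 * delta * mubar by rewrite !mulr_ge0.
rewrite real_normK ?num_real//.
have [u01|u01] := boolP (0 <= u < 1); last first.
  rewrite !mixture_draw_outside// subrr expr0n.
  by apply: addr_ge0 => //; exact: sumr_ge0.
have [i iu] := cell_exists w1 u01; have [j ju] := cell_exists w1' u01.
rewrite (mixture_draw_cell z w0 iu) (mixture_draw_cell z w0' ju).
have [ij|ij] := eqVneq i j.
- subst j; apply: le_trans (lerD (lexx _) (le_trans (aG i) (le_term_sum i G0))).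
  have dmu := sqr_normB_le (mu i) (mu' i) (le_trans (location_dist _ _ i) dd).
  have dsg := sqr_normB_le (sg i).1 (sg' i).1 (le_trans (scale_dist _ _ i) dd).
  have := ler_wpM2r (sqr_ge0 (z i)) dsg; rewrite /a.
  move: dmu; set p := location theta i; set q := location theta' i.
  set x := scale theta i; set y := scale theta' i => dmu dsgz.
  (* This square gives (v + w)^2 <= 2 v^2 + 2 w^2 with v = p - q and w = (x - y) z_i. *)
  have := sqr_ge0 (p - q - (x - y) * z i).
  by lra.
- have [ei ej] := cell_ends_ge1 w0 w0' dd iu ju ij.
  have GG : G i + G j <= \sum_l G l.
    rewrite (bigD1 i)//= (bigD1 j)/=; last by rewrite eq_sym.
    by rewrite lerD2l lerDl sumr_ge0.
  apply: (@le_trans _ _ (b i + b j)); last first.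
    by apply: le_trans (lerD (bG i ei) (bG j ej)) (le_trans GG _); rewrite lerDr.
  have sq l (x c : R) : `|x| <= c -> (x * l) ^+ 2 <= c ^+ 2 * l ^+ 2.
    move=> xc; rewrite exprMn ler_wpM2r ?sqr_ge0//.
    by rewrite -real_normK ?num_real// ler_pXn2r// nnegrE (le_trans _ xc).
  have si := sq (z i) _ _ (sg i).1; have sj := sq (z j) _ _ (sg' j).1.
  have mi := sq 1 _ _ (mu i); have mj := sq 1 _ _ (mu' j).
  rewrite !mulr1 expr1n !mulr1 in mi mj; rewrite /b.
  move: si sj mi mj; set p := location theta i; set q := location theta' j.
  set x := scale theta i * z i; set y := scale theta' j * z j.
  move=> *.
  apply: (@le_trans _ _ (4 * p ^+ 2 + 4 * q ^+ 2 + 4 * x ^+ 2 + 4 * y ^+ 2)).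
    (* Four times the sum of the squares of p, x, -q, -y exceeds the square of their sum by exactly
       the six squared pairwise differences. *)
    have := sqr_ge0 (p + q); have := sqr_ge0 (p - x); have := sqr_ge0 (p + y).
    have := sqr_ge0 (q + x); have := sqr_ge0 (q - y); have := sqr_ge0 (x + y).
    by lra.
  by lra.
Qed.

(** * Integration of the pointwise bound *)

Lemma expectation_affine_sqr_le d (T : measurableType d) (R : realType)
    (P : probability T R) (Z : {RV P >-> R}) (CZ p q : R) : 0 <= p -> 0 <= q ->
  ('E_P[fun x => (`|Z x| ^+ 2)%R] <= (CZ ^+ 2)%:E)%E ->
  (\int[P]_x (p + q * Z x ^+ 2)%:E <= (p + q * CZ ^+ 2)%:E)%E.
Proof.
rewrite unlock => p0 q0 ZC.
have mZ : measurable_fun setT (fun x => (Z x ^+ 2)%:E).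
  by apply/measurable_EFinP; apply: measurable_funX; exact: measurable_funPT.
under eq_integral do rewrite EFinD EFinM.
rewrite ge0_integralD//; last 2 first.
- by move=> x _; rewrite -EFinM lee_fin mulr_ge0 ?sqr_ge0.
- by apply: emeasurable_funM => //; exact: measurable_cst.
rewrite integral_cst// ge0_integralZl_EFin//; last first.
  by move=> x _; rewrite lee_fin sqr_ge0.
rewrite [X in (_ * X + _)%E](probability_setT P) mule1 EFinD EFinM leeD2l// lee_wpmul2l//.
apply: le_trans ZC; rewrite le_eqVlt; apply/orP; left; apply/eqP.
by apply: eq_integral => x _; rewrite real_normK ?num_real.
Qed.

Lemma integral_uniform_ball_affine_sqr_le d (T : measurableType d) (R : realType)
    (P : probability T R) (I : Type) (nu : {RV P >-> R}) (Z : I -> {RV P >-> R})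
    (i : I) (CZ p q c r : R) :
  uniform01 nu -> indep_of_family P nu (fun j => Z j : T -> R) ->
  ('E_P[fun x => (`|Z i x| ^+ 2)%R] <= (CZ ^+ 2)%:E)%E ->
  0 <= p -> 0 <= q -> 0 <= r ->
  (\int[P]_x ((\1_(`[(c - r)%R, (c + r)%R]) (nu x))%:E * (p + q * Z i x ^+ 2)%:E)
   <= (2 * r * (p + q * CZ ^+ 2))%:E)%E.
Proof.
move=> unif indep ZC p0 q0 r0.
pose f (y : R) := (p + q * y ^+ 2)%:E.
rewrite (integral_indic_indep (f := f) _ indep)//; last 2 first.
- apply/measurable_EFinP; apply: measurable_funD => //.
  by apply: measurable_funM => //; exact: measurable_funX.
- by move=> y; rewrite lee_fin addr_ge0// mulr_ge0 ?sqr_ge0.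
rewrite EFinM lee_pmul//.
- by apply: integral_ge0 => x _; rewrite lee_fin addr_ge0// mulr_ge0 ?sqr_ge0.
- have -> : P (nu @^-1` `[c - r, c + r]) = uniform_prob (@ltr01 R) `[c - r, c + r].
    by rewrite -unif.
  exact: uniform_prob_ball_le.
- exact: expectation_affine_sqr_le.
Qed.

Lemma local_sup_L2_le d (T : measurableType d) (R : realType)
    (P : probability T R) (k : nat) (mubar sigbar siglow CZ delta : R)
    (nu : {RV P >-> R}) (Z : 'I_k -> {RV P >-> R}) (theta : mixture R k) :
  uniform01 nu -> indep_of_family P nu (fun j => Z j : T -> R) ->
  (forall j, ('E_P[fun x => (`|Z j x| ^+ 2)%R] <= (CZ ^+ 2)%:E)%E) ->
  in_sieve mubar sigbar siglow theta ->
  0 <= delta -> 0 <= mubar -> 0 <= sigbar ->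
  (local_sup_L2 P mubar sigbar siglow nu (fun j => Z j : T -> R) theta delta
   <= (Num.sqrt (4 * delta * (mubar + k%:R * (sigbar * CZ ^+ 2
         + 4 * mubar ^+ 2 + 4 * sigbar ^+ 2 * CZ ^+ 2))))%:E)%E.
Proof.
move=> unif indep ZC sieve d0 m0 s0.
pose c1 := 4 * delta * sigbar.
pose c2 := 4 * mubar ^+ 2.
pose c3 := 4 * sigbar ^+ 2.
have c10 : 0 <= c1 by rewrite !mulr_ge0.
have c20 : 0 <= c2 by rewrite mulr_ge0 ?sqr_ge0.
have c30 : 0 <= c3 by rewrite mulr_ge0 ?sqr_ge0.
have g0 j x : 0 <= c2 + c3 * Z j x ^+ 2 by rewrite addr_ge0// mulr_ge0 ?sqr_ge0.
have mZ j : measurable_fun setT (fun x => Z j x ^+ 2).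
  by apply: measurable_funX; exact: measurable_funPT.
pose ball m := `[(cum_weight theta m - delta)%R, (cum_weight theta m + delta)%R].
(* The summand 0 puts [G1] in the affine form of [expectation_affine_sqr_le], with p = 0. *)
pose G1 j x := (0 + c1 * Z j x ^+ 2)%:E.
pose G2 m j x := ((\1_[set` ball m] (nu x))%:E * (c2 + c3 * Z j x ^+ 2)%:E)%E.
have mG1 j : measurable_fun setT (G1 j).
  apply/measurable_EFinP; apply: measurable_funD => //.
  exact: measurable_funM.
have mG2 m j : measurable_fun setT (G2 m j).
  apply: emeasurable_funM; apply/measurable_EFinP.
    by apply: measurableT_comp => //; exact: measurable_funPT.
  by apply: measurable_funD => //; exact: measurable_funM.
have G10 j x : (0 <= G1 j x)%E by rewrite lee_fin add0r mulr_ge0 ?sqr_ge0.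
have G20 m j x : (0 <= G2 m j x)%E by rewrite mule_ge0 ?lee_fin.
pose G j x := (G1 j x + (G2 j j x + G2 j.+1 j x))%E.
have G0 j x : (0 <= G j x)%E by rewrite !adde_ge0.
have mG j : measurable_fun setT (G j) by do 2 apply: emeasurable_funD => //.
have intG : (\int[P]_x ((4 * delta * mubar)%:E + \sum_(j < k) G j x) <=
    (4 * delta * (mubar + k%:R * (sigbar * CZ ^+ 2
         + 4 * mubar ^+ 2 + 4 * sigbar ^+ 2 * CZ ^+ 2)))%:E)%E.
  rewrite ge0_integralD//; last 3 first.
  - by move=> x _; rewrite lee_fin !mulr_ge0.
  - by move=> x _; apply: sume_ge0.
  - exact: emeasurable_sum.
  rewrite integral_cst// [X in (_ * X + _)%E](probability_setT P) mule1 ge0_integral_sum//.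
  (* Component j contributes [c1 * CZ ^+ 2] from equal indices, and one term with factor 2 delta for
     each of the two balls at its cell ends. *)
  rewrite [leRHS](_ : _ = (4 * delta * mubar)%:E + \sum_(j < k)
      (c1 * CZ ^+ 2 + (2 * delta * (c2 + c3 * CZ ^+ 2)
         + 2 * delta * (c2 + c3 * CZ ^+ 2)))%:E)%E; last first.
    rewrite sumEFin -EFinD sumr_const card_ord.
    by congr EFin; rewrite /c1 /c2 /c3; ring.
  rewrite leeD2l//; apply: lee_sum => j _.
  rewrite !ge0_integralD//; last 2 first.
  - by move=> x _; rewrite adde_ge0.
  - exact: emeasurable_funD.
  rewrite !EFinD; apply: leeD; last by apply: leeD;
    exact: integral_uniform_ball_affine_sqr_le.
  by rewrite -[leRHS]add0r; exact: expectation_affine_sqr_le.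
rewrite /local_sup_L2; set F := fun x => ereal_sup _.
(* The choice theta' = theta gives the value 0, so the supremum is not that of an empty set. *)
have F0 x : (0 <= F x)%E.
  apply: le_ereal_sup_tmp; exists 0%E => //=; exists theta.
    by split => //; rewrite /mixture_dist !big1 ?addr0// => j _; rewrite subrr normr0.
  by rewrite subrr normr0 expr0n.
have FG x : (F x <= (4 * delta * mubar)%:E + \sum_(j < k) G j x)%E.
  apply: ge_ereal_sup => _ [theta' [sieve' dd] <-].
  have := sqr_mixture_draw_dist (nu x) (Z^~ x) sieve sieve' dd m0 s0.
  rewrite -lee_fin => /le_trans; apply.
  rewrite EFinD -sumEFin leeD2l//; apply: lee_sum => j _.
  rewrite /G /G1 /G2 -!EFinM -!EFinD lee_fin add0r /cell_ends /c1 /c2 /c3.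
  by rewrite lerD2l -mulrDl.
have IF := le_trans (ge0_le_integral_nonmeas P F0 FG) intG.
have I0 : (0 <= \int[P]_x F x)%E by apply: integral_ge0 => x _; exact: F0.
have IG := le_trans I0 IF.
rewrite -powR12_sqrt -?poweR_EFin; last by rewrite -lee_fin.
by apply: gt0_ler_poweR => //; rewrite in_itv/= leey andbT.
Qed.

(** * Constants and the final estimate *)

(** With S the sum in parentheses, each of mubar, kk sigbar, kk mubar^2 and kk sigbar^2 is at most L
    S^2. The coefficients 4 and 16 add up to 20, both with and without the factor CZ^2, and 20 <=
    8^2. The parameter L covers large and small k at once. *)
Lemma moment_bound_le (R : realType) (mubar sigbar CZ kk L : R) :
  0 <= mubar -> 0 <= sigbar -> 1 <= kk -> 1 <= L ->
  mubar ^+ 2 * kk <= L * (1 + mubar + sigbar + kk) ^+ 2 ->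
  sigbar ^+ 2 * kk <= L * (1 + mubar + sigbar + kk) ^+ 2 ->
  4 * (mubar + kk * (sigbar * CZ ^+ 2 + 4 * mubar ^+ 2
                     + 4 * sigbar ^+ 2 * CZ ^+ 2))
  <= (8 * (1 + `|CZ|) * L * (1 + mubar + sigbar + kk)) ^+ 2.
Proof.
move=> m0 s0 k1 L1.
set S := 1 + mubar + sigbar + kk => hm hs.
have S1 : 1 <= S by rewrite /S; lra.
have LS : S ^+ 2 <= L * S ^+ 2 by rewrite ler_peMl ?sqr_ge0.
have mS : mubar <= L * S ^+ 2.
  apply: le_trans LS; apply: (@le_trans _ _ (1 * S)); first by rewrite /S; lra.
  by rewrite expr2 ler_wpM2r//; lra.
have sS : sigbar * kk <= L * S ^+ 2.
  by apply: le_trans LS; rewrite expr2; apply: ler_pM; rewrite /S; lra.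
have C0 := sqr_ge0 CZ.
have sC := ler_wpM2r C0 sS; have hC := ler_wpM2r C0 hs.
apply: (@le_trans _ _ (20 * (1 + CZ ^+ 2) * (L * S ^+ 2))); first lra.
have LL : L * S ^+ 2 <= L ^+ 2 * S ^+ 2.
  by rewrite ler_wpM2r ?sqr_ge0// expr2 ler_peMl//; lra.
rewrite -[leLHS]mulrA.
have -> : (8 * (1 + `|CZ|) * L * S) ^+ 2
          = 64 * ((1 + `|CZ|) ^+ 2 * (L ^+ 2 * S ^+ 2)) by ring.
have CC : 1 + CZ ^+ 2 <= (1 + `|CZ|) ^+ 2.
  by rewrite -(@real_normK _ CZ) ?num_real//; have := normr_ge0 CZ; lra.
have LS0 : 0 <= L * S ^+ 2 by rewrite mulr_ge0 ?sqr_ge0//; lra.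
have C10 : 0 <= 1 + CZ ^+ 2 by lra.
apply: ler_pM; [lra|exact: mulr_ge0|lra|].
exact: ler_pM.
Qed.

(* [C], a function of C_Z alone, serves every sieve and every [k n >= K], where
   [K] is a threshold attached to the sieve, which the O-restrictions need; for
   the finitely many sizes below [K] the constant [C'] of C_Z may depend on the
   sieve, but on nothing else. *)
Theorem lemma1 (R : realType) :
  exists C : R -> R,
  forall (b sigbar : R) (mubar siglow : nat -> R),
  0 < b ->
  (mubar : nat -> R^o) =O_\oo (fun m : nat => ln m%:R `^ b^-1 : R^o) ->
  (siglow : nat -> R^o) =O_\oo (fun m : nat => ln m%:R `^ (2 / b) / m%:R : R^o) ->
  exists (K : nat) (C' : R -> R),
  forall (d : measure_display) (T : measurableType d) (P : probability T R)
    (CZ : R) (k : nat -> nat) (n : nat)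
    (nu : nat -> nat -> {RV P >-> R})
    (Z : nat -> nat -> 'I_(k n) -> {RV P >-> R}),
  (forall m, (1 <= k m)%N) ->
  (forall t s, uniform01 (nu t s)) ->
  (forall t s, indep_of_family P (nu t s) (fun j => Z t s j : T -> R)) ->
  (forall t s j, ('E_P[fun x => (`|Z t s j x| ^+ 2)%R] <= (CZ ^+ 2)%:E)%E) ->
  forall (t s : nat) (theta : mixture R (k n)) (delta : R),
  in_sieve (mubar (k n)) sigbar (siglow (k n)) theta ->
  0 <= delta ->
  (local_sup_L2 P (mubar (k n)) sigbar (siglow (k n))
     (nu t s) (fun j => Z t s j : T -> R) theta delta
   <= ((if (K <= k n)%N then C CZ else C' CZ)
       * (1 + mubar (k n) + sigbar + (k n)%:R) * Num.sqrt delta)%:E)%E.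
Proof.
exists (fun CZ => 8 * (1 + `|CZ|)) => b sigbar mubar siglow b0 muO _.
have [K [_ Kmu Ksig]] : exists K, [/\ (0 < K)%N,
    forall m, (K <= m)%N -> mubar m ^+ 2 <= m%:R
  & forall m, (K <= m)%N -> sigbar ^+ 2 <= m%:R].
  have b'0 : 0 < b^-1 by rewrite invr_gt0.
  have [K1 _ HK1] := bigO_ln_powR_sqr_le b'0 muO.
  have [K2 _ HK2] := nbhs_infty_ger (sigbar ^+ 2).
  exists (maxn 1 (maxn K1 K2)); split; first by rewrite leq_max.
  - by move=> m; rewrite !geq_max => /and3P[_ ? _]; exact: HK1.
  - by move=> m; rewrite !geq_max => /and3P[_ _ ?]; exact: HK2.
exists K, (fun CZ => 8 * (1 + `|CZ|) * K%:R).
move=> d T P CZ k n nu Z k1 unif indep ZC t s theta delta sieve d0.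
have [_ _ mu sg] := sieve.
(* As k n >= 1 there is a component, and the bounds on its parameters force mubar and sigbar to be
   nonnegative. *)
have m0 : 0 <= mubar (k n) by exact: le_trans (mu (Ordinal (k1 n))).
have s0 : 0 <= sigbar by apply: le_trans (sg (Ordinal (k1 n))).1.
have kn1 : 1 <= ((k n)%:R : R) by rewrite ler1n.
apply: le_trans (local_sup_L2_le (unif t s) (indep t s) (ZC t s) sieve d0 m0 s0) _.
set S := 1 + mubar (k n) + sigbar + (k n)%:R.
have S1 : 1 <= S by rewrite /S; lra.
(* For k n >= K take L = 1, since x^2 and k n are both at most S. Below K take L = K, since x <= S
   and k n < K. *)
have [L [L1 LE Lk]] : exists L : R, [/\ 1 <= L,
    (if (K <= k n)%N then 8 * (1 + `|CZ|) else 8 * (1 + `|CZ|) * K%:R)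
      = 8 * (1 + `|CZ|) * L
  & forall x, 0 <= x -> x <= S -> ((K <= k n)%N -> x ^+ 2 <= (k n)%:R) ->
      x ^+ 2 * (k n)%:R <= L * S ^+ 2].
  have [Kk|kK] := leqP K (k n).
    exists 1; split => //; first by rewrite mulr1.
    move=> x x0 xS /(_ isT) xk; rewrite mul1r [S ^+ 2]expr2.
    have kS : (k n)%:R <= S by rewrite /S; lra.
    by apply: ler_pM => //; [exact: sqr_ge0|exact: le_trans kS].
  exists K%:R; split => //; first by rewrite ler1n (leq_ltn_trans _ kK).
  move=> x x0 xS _; rewrite mulrC ler_pM// ?sqr_ge0//.
    by rewrite ler_nat ltnW.
  by rewrite ler_pXn2r// nnegrE; lra.
have CLS0 : 0 <= 8 * (1 + `|CZ|) * L * S.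
  by rewrite mulr_ge0 ?mulr_ge0 ?addr_ge0//; lra.
rewrite LE lee_fin [4 * delta]mulrC -[X in Num.sqrt X]mulrA sqrtrM// mulrC.
rewrite ler_wpM2r ?sqrtr_ge0// -(ger0_norm CLS0) -sqrtr_sqr ler_wsqrtr//.
apply: moment_bound_le => //; apply: Lk => //.
- by rewrite /S; lra.
- exact: Kmu.
- by rewrite /S; lra.
- exact: Ksig.
Qed.
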